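(* Let $d\ge2$, $\mathbb{I}=[0,1]$, and let $\varphi_{pq}\in C(\mathbb{I})$, $p=1,\dots,d$, $q=1,\dots,2d+1$, be universal (Kolmogorov) continuous functions, i.e. functions such that every $f\in C(\mathbb{I}^d)$ admits a representation $f(x)=\sum_{q=1}^{2d+1}g_q\big(\sum_{p=1}^d\varphi_{pq}(x_p)\big)$, $x=(x_1,\dots,x_d)\in\mathbb{I}^d$, with some $g_q\in C(\mathbb{R})$ depending on $f$. Then every function $f:\mathbb{I}^d\to\mathbb{R}$ (not necessarily continuous) can be represented in the form $$f(x)=\sum_{q=1}^{2d+1}g_q\Big(\sum_{p=1}^d\varphi_{pq}(x_p)\Big),\qquad x=(x_1,\dots,x_d)\in\mathbb{I}^d,$$ where $g_q:\mathbb{R}\to\mathbb{R}$ are univariate functions depending on $f$.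
   Context: Kolmogorov's superposition theorem asserts that universal functions $\varphi_{pq}$ as described in the claim exist for every $d\ge2$. The functions $g_q$ in the conclusion are arbitrary (no continuity is claimed). *)

(* Defs.v *)
From HB Require Import structures.
From mathcomp Require Import all_boot all_order all_algebra.
From mathcomp Require Import all_classical all_reals all_analysis.

Set Implicit Arguments.
Unset Strict Implicit.
Unset Printing Implicit Defensive.

Import Order.TTheory GRing.Theory Num.Theory.
Import numFieldNormedType.Exports.

Local Open Scope classical_set_scope.
Local Open Scope ring_scope.

(* Points of R^d are row vectors. Functions on the unit interval or on the
   cube are total functions, considered only on that set: continuity is
   continuity for the subspace topology. *)
Definition cube (R : realType) (d : nat) : set 'rV[R]_d :=
  [set x | forall p : 'I_d, x ord0 p \in `[0, 1]].
Arguments cube : clear implicits.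

Definition superposition (R : realType) (d m : nat)
    (phi : 'I_d -> 'I_m -> R -> R) (g : 'I_m -> R -> R) (x : 'rV[R]_d) : R :=
  \sum_(q < m) g q (\sum_(p < d) phi p q (x ord0 p)).

Definition kolmogorov_universal (R : realType) (d : nat)
    (phi : 'I_d -> 'I_(2 * d + 1) -> R -> R) : Prop :=
  (forall p q, {within `[0, 1], continuous (phi p q)}) /\
  (forall f : 'rV[R]_d -> R, {within cube R d, continuous f} ->
     exists g : 'I_(2 * d + 1) -> R -> R,
       (forall q, continuous (g q)) /\
       (forall x, cube R d x -> f x = superposition phi g x)).

(* Main.v *)
(* Only interpolation of finite data by continuous functions matters: it makes
   universality solve, for every finite set of points [x], the equations
   [sum_q u (q, h_q x) = f x] in the unknowns [u (q, t)].  Each equation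
   involves finitely many unknowns, and such a linear system over a field is
   solvable as soon as all its finite subsystems are. *)
Require Import Defs.
From mathcomp Require Import all_boot all_order all_algebra.
From mathcomp Require Import all_classical all_reals all_analysis.

Import Order.TTheory GRing.Theory Num.Theory.
Import numFieldNormedType.Exports.

Local Open Scope classical_set_scope.
Local Open Scope ring_scope.

Section LinearSystems.
Variables (K : fieldType) (I T : eqType) (Q : finType).
Variables (D : set T) (a : T -> Q -> K) (h : T -> Q -> I) (f : T -> K).

Definition solution_at (u : I -> K) (x : T) : Prop :=
  \sum_q a x q * u (h x q) = f x.

(** [A] prescribes values of some unknowns. It need not be functional a priori: two values at one
    unknown would leave no [u]. *)
Definition solution_on (A : set (I * K)) (s : seq T) (u : I -> K) : Prop :=
  (forall i v, A (i, v) -> u i = v) /\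
  (forall x, x \in s -> D x -> solution_at u x).

Definition finitely_solvable (A : set (I * K)) : Prop :=
  forall s, exists u, solution_on A s u.

Lemma solution_at_affine (u v : I -> K) (t : K) (x : T) :
  solution_at u x -> solution_at v x ->
  solution_at (fun i => u i + t * (v i - u i)) x.
Proof.
rewrite /solution_at => ux vx.
under eq_bigr do rewrite mulrDr mulrCA mulrBr.
by rewrite big_split -mulr_sumr sumrB /= ux vx subrr mulr0 addr0.
Qed.

Lemma eq_solution_at (u v : I -> K) (x : T) :
  (forall q, u (h x q) = v (h x q)) -> solution_at u x -> solution_at v x.
Proof. by rewrite /solution_at => uv <-; apply: eq_bigr => q _; rewrite uv. Qed.

(** Both pairs lie in the larger of two members of the chain, and any solution extending that member
    takes both values at [i]. *)
Lemma chain_functional (F : set (set (I * K))) (i : I) (v w : K) :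
  F `<=` finitely_solvable -> total_on F subset ->
  (\bigcup_(X in F) X) (i, v) -> (\bigcup_(X in F) X) (i, w) -> v = w.
Proof.
move=> FP Ftot [B FB Biv] [C FC Ciw]; have [BC|CB] := Ftot _ _ FB FC.
- have [u [uC _]] := FP _ FC [::].
  by rewrite -(uC _ _ Ciw) (uC _ _ (BC _ Biv)).
- have [u [uB _]] := FP _ FB [::].
  by rewrite -(uB _ _ (CB _ Ciw)) (uB _ _ Biv).
Qed.

(** Each unknown of [l] gets at most one value from the union, hence from one member; the largest of
    these finitely many members serves for all of [l]. *)
Lemma chain_finite_domain (F : set (set (I * K))) (l : seq I) :
  F `<=` finitely_solvable -> total_on F subset -> F !=set0 ->
  exists2 A, F A & forall i, i \in l ->
    forall v, (\bigcup_(X in F) X) (i, v) -> A (i, v).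
Proof.
move=> FP Ftot [A0 FA0]; elim: l => [|i l [A FA Al]]; first by exists A0.
have [[v [B FB Biv]]|noval] := pselect (exists v, (\bigcup_(X in F) X) (i, v)).
- have valE w : (\bigcup_(X in F) X) (i, w) -> w = v.
    by move=> iw; apply: chain_functional iw _ => //; exists B.
  have [AB|BA] := Ftot _ _ FA FB.
  + exists B => // j; rewrite inE => /orP[/eqP -> w /valE -> //|jl w /(Al _ jl)].
    exact: AB.
  + exists A => // j; rewrite inE => /orP[/eqP -> w /valE ->|].
      exact: BA.
    exact: Al.
- exists A => // j; rewrite inE => /orP[/eqP -> w iw|]; last exact: Al.
  by case: noval; exists w.
Qed.

Lemma finitely_solvable_bigcup (F : set (set (I * K))) :
  finitely_solvable set0 ->
  F `<=` finitely_solvable -> total_on F subset ->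
  finitely_solvable (\bigcup_(X in F) X).
Proof.
move=> P0 FP Ftot s.
have [F0|/set0P/negP/negPn/eqP ->] := pselect (F !=set0); last first.
  by rewrite bigcup_set0; exact: P0.
pose l := flatten [seq [seq h x q | q <- enum Q] | x <- s].
have hl x q : x \in s -> h x q \in l.
  move=> xs; apply/flattenP; exists [seq h x r | r <- enum Q].
    exact: (map_f (fun y => [seq h y r | r <- enum Q])).
  by rewrite map_f// mem_enum.
have [A FA Al] := chain_finite_domain F l FP Ftot F0.
have [u [uA us]] := FP _ FA s.
pose U := \bigcup_(X in F) X.
(* [u'] follows the union where it prescribes a value and [u] elsewhere. On [l], which holds all
   unknowns of the equations in [s], it agrees with [u]. *)
pose u' i := xget (u i) [set v | U (i, v)].
exists u'; split=> [i v Uiv|x xs Dx].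
- apply: (chain_functional _ _ _ _ FP Ftot _ Uiv).
  by apply: (@xgetPex _ _ [set w | U (i, w)]); exists v.
- apply: eq_solution_at (us x xs Dx) => q; rewrite /u'.
  by case: xgetP => // v _ /(Al _ (hl x q xs)) /uA.
Qed.

(* The values at [i] of the solutions of a finite subsystem form an affine
   subspace of [K]: a point, which is then the only choice, or all of [K]. *)
Lemma finitely_solvable_extend (A : set (I * K)) (i : I) :
  finitely_solvable A -> exists c, finitely_solvable (A `|` [set (i, c)]).
Proof.
move=> PA.
have [[s0 [c c0]]|nuniq] :=
  pselect (exists s0 c, forall u, solution_on A s0 u -> u i = c).
- exists c => s; have [u [uA us]] := PA (s0 ++ s); exists u; split.
  + move=> j v [/uA //|[-> ->]]; apply: c0; split=> // x xs0.
    by apply: us; rewrite mem_cat xs0.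
  + by move=> x xs; apply: us; rewrite mem_cat xs orbT.
(* No finite subsystem determines the value at [i], so any value would do; the coefficient below
   makes the affine combination of [u] and [v] vanish at [i]. *)
- exists 0 => s; have [u [uA us]] := PA s.
  have [v [vA vs] vi] : exists2 v, solution_on A s v & v i != u i.
    apply: contrapT => nv; apply: nuniq; exists s, (u i) => v sv.
    by apply/eqP; apply: contrapT => vi; apply: nv; exists v => //; apply/negP.
  exists (fun j => u j + (- u i / (v i - u i)) * (v j - u j)); split.
  + move=> j w [Ajw|[-> ->]].
      by rewrite (uA _ _ Ajw) (vA _ _ Ajw) subrr mulr0 addr0.
    by rewrite divfK ?subr_eq0// subrr.
  + by move=> x xs Dx; apply: solution_at_affine; [exact: us | exact: vs].
Qed.

(* Zorn's lemma on the partial assignments [A] of values to unknowns, encoded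
   as sets of pairs, that extend to a solution of every finite subsystem. *)
Lemma finitely_solvable_solvable :
  (forall s : seq T, exists u, forall x, x \in s -> D x -> solution_at u x) ->
  exists u, forall x, D x -> solution_at u x.
Proof.
move=> fin.
have P0 : finitely_solvable set0.
  by move=> s; have [u us] := fin s; exists u; split.
have [M [PM Mmax]] := Zorn_bigcup (fun F FP => finitely_solvable_bigcup F P0 FP).
(* A maximal [M] is total: a missing unknown could be added to it. *)
have /choice[u Mu] : forall i, exists v, M (i, v).
  move=> i; apply: contrapT => Mi; have [c Pc] := finitely_solvable_extend M i PM.
  apply: Mmax Pc; split; first by left.
  by move=> /(_ (i, c)) Mic; apply: Mi; exists c; apply: Mic; right.
exists u => x Dx; have [w [wM wx]] := PM [:: x].
by apply: eq_solution_at (wx x (mem_head _ _) Dx) => q; exact: wM.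
Qed.

End LinearSystems.

Lemma continuous_prod_dist (R : realType) (V : normedModType R) (s : seq V) :
  continuous (fun x : V => \prod_(b <- s) `|x - b| : R).
Proof.
elim: s => [|b s IHs] x.
  by under eq_fun do rewrite big_nil; exact: cvg_cst.
under eq_fun do rewrite big_cons.
apply: cvgM; last exact: IHs.
by apply: cvg_norm; apply: cvgB; [exact: cvg_id | exact: cvg_cst].
Qed.

(** Newton interpolation, with products of distances to the earlier nodes in place of
    polynomials. *)
Lemma continuous_interpolation (R : realType) (V : normedModType R)
    (f : V -> R) (s : seq V) :
  exists2 F : V -> R, continuous F & {in s, F =1 f}.
Proof.
elim: s => [|a s [F Fc Fs]]; first by exists (cst 0) => // x; exact: cvg_cst.
have [as_|as_] := boolP (a \in s).
  by exists F => // x; rewrite inE => /orP[/eqP ->|]; exact: Fs.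
pose P x : R := \prod_(b <- s) `|x - b|.
have Ps x : (P x == 0) = (x \in s).
  rewrite /P prodf_seq_eq0; apply/hasP/idP => [[b bs]|xs].
    by rewrite normr_eq0 subr_eq0 => /eqP ->.
  by exists x; rewrite // subrr normr0 /=.
exists (fun x => F x + (f a - F a) / P a * P x).
  move=> x; apply: cvgD; first exact: Fc.
  by apply: cvgM; [exact: cvg_cst | exact: continuous_prod_dist].
move=> x; rewrite inE => /orP[/eqP ->|xs].
  by rewrite divfK ?Ps// addrC subrK.
by move: (xs); rewrite -Ps => /eqP ->; rewrite mulr0 addr0 Fs.
Qed.

Theorem theorem4p2 (R : realType) (d : nat) (hd : (2 <= d)%N)
    (phi : 'I_d -> 'I_(2 * d + 1) -> R -> R)
    (hphi : kolmogorov_universal phi)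
    (f : 'rV[R]_d -> R) :
  exists g : 'I_(2 * d + 1) -> R -> R,
    forall x : 'rV[R]_d, cube R d x -> f x = superposition phi g x.
Proof.
have [_ univ] := hphi.
(* The tag [q] keeps the unknowns of different outer functions apart even when their inner sums
   coincide. *)
pose h (x : 'rV[R]_d) (q : 'I_(2 * d + 1)) := (q, \sum_(p < d) phi p q (x ord0 p)).
have [s|u usol] := finitely_solvable_solvable R _ _ _ (cube R d) (fun _ _ => 1) h f.
  have [F Fc Fs] := continuous_interpolation R 'rV[R]_d f s.
  have [g [_ gF]] := univ F (continuous_subspaceT Fc).
  exists (fun i => g i.1 i.2) => x xs cx.
  rewrite /solution_at -(Fs x xs) gF//.
  by apply: eq_bigr => q _; rewrite mul1r.
exists (fun q t => u (q, t)) => x cx; rewrite -(usol x cx).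
by apply: eq_bigr => q _; rewrite mul1r.
Qed.
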